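(* There is no countable planar graph $U$ such that every countable planar graph is a topological minor of $U$.
   Context: Graphs may be infinite. A graph is planar if it has a plane embedding: vertices are mapped to distinct points of $\mathbb R^2$ and edges to polygonal arcs joining the images of their endpoints, such that distinct arcs are internally disjoint and no arc passes through the image of a vertex other than its endpoints (accumulation points of the image are allowed). For graphs $G,H$, a $G$-embedding of $H$ assigns to each vertex $v$ of $H$ a vertex $\iota(v)$ of $G$, injectively, and to each edge $uv$ of $H$ an $\iota(u)$--$\iota(v)$-path $\iota(uv)$ in $G$, such that paths assigned to distinct edges are internally disjoint and the interior vertices of these paths are not images of vertices of $H$. $H$ is a topological minor of $G$ if there is a $G$-embedding of $H$ (i.e. $G$ contains a subdivision of $H$ as a subgraph). *)

(* Defs.v *)
From mathcomp Require Import all_boot all_order all_algebra.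
From mathcomp Require Import all_classical all_reals.

Set Implicit Arguments.
Unset Strict Implicit.
Unset Printing Implicit Defensive.

Import Order.TTheory GRing.Theory Num.Theory.

Local Open Scope classical_set_scope.
Local Open Scope ring_scope.

Record sgraph : Type := SGraph {
  vertex :> eqType;
  edge : rel vertex;
  edge_sym : symmetric edge;
  edge_irrefl : irreflexive edge }.

Arguments edge {s}.

(* Since edges are unordered pairs of vertices, a countable vertex set also
   makes the edge set countable; finite graphs are included. *)
Definition countable_graph (G : sgraph) : Prop := countable [set: G].

(* uv and u'v' are the same unordered pair. *)
Definition same_edge (G : sgraph) (u v u' v' : G) : bool :=
  ((u == u') && (v == v')) || ((u == v') && (v == u')).

Section PolygonalArcs.
Variable R : realType.

Definition segment (a b : 'rV[R]_2) : set 'rV[R]_2 :=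
  [set (1 - t) *: a + t *: b | t in `[0, 1]].

Definition side (s : seq 'rV[R]_2) (i : nat) : set 'rV[R]_2 :=
  segment (nth 0 s i) (nth 0 s i.+1).

Definition chain_support (s : seq 'rV[R]_2) : set 'rV[R]_2 :=
  \bigcup_(i in [set i | (i.+1 < size s)%N]) side s i.

Definition simple_chain (s : seq 'rV[R]_2) : Prop :=
  uniq s /\
  forall i j : nat, (i < j)%N -> (j.+1 < size s)%N ->
    side s i `&` side s j = if j == i.+1 then [set nth 0 s j] else set0.

Definition polygonal_arc (x y : 'rV[R]_2) (A : set 'rV[R]_2) : Prop :=
  exists s : seq 'rV[R]_2,
    [/\ (1 < size s)%N, head 0 s = x, last 0 s = y, simple_chain s
      & A = chain_support s].

End PolygonalArcs.

Record plane_embedding (R : realType) (G : sgraph)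
    (pos : G -> 'rV[R]_2) (arc : G -> G -> set 'rV[R]_2) : Prop := {
  pos_inj : injective pos;
  (* arc is a function of the unordered pair uv *)
  arc_sym : forall u v : G, edge u v -> arc v u = arc u v;
  arc_polygonal : forall u v : G, edge u v ->
    polygonal_arc (pos u) (pos v) (arc u v);
  arc_disjoint : forall u v u' v' : G, edge u v -> edge u' v' ->
    ~~ same_edge u v u' v' ->
    (arc u v `\` [set pos u; pos v]) `&`
      (arc u' v' `\` [set pos u'; pos v']) = set0;
  arc_vertex : forall u v w : G, edge u v ->
    arc u v (pos w) -> w = u \/ w = v }.

Definition planar (R : realType) (G : sgraph) : Prop :=
  exists (pos : G -> 'rV[R]_2) (arc : G -> G -> set 'rV[R]_2),
    plane_embedding pos arc.

(* A path is given by the list of all its vertices, both ends included. *)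
Definition graph_path (G : sgraph) (x y : G) (s : seq G) : Prop :=
  exists2 p : seq G, s = x :: p
    & [/\ path edge x p, last x p = y & uniq (x :: p)].

Record graph_embedding (H G : sgraph)
    (iota : H -> G) (ipath : H -> H -> seq G) : Prop := {
  iota_inj : injective iota;
  (* up to its direction, the path is a function of the unordered pair uv *)
  ipath_sym : forall u v : H, edge u v -> ipath v u = rev (ipath u v);
  ipath_path : forall u v : H, edge u v ->
    graph_path (iota u) (iota v) (ipath u v);
  ipath_disjoint : forall (u v u' v' : H) (z : G), edge u v -> edge u' v' ->
    ~~ same_edge u v u' v' ->
    z \in ipath u v -> z \in ipath u' v' ->
    (z \in [:: iota u; iota v]) || (z \in [:: iota u'; iota v']);
  ipath_vertex : forall u v w : H, edge u v ->
    iota w \in ipath u v -> w = u \/ w = v }.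

Definition topological_minor (H G : sgraph) : Prop :=
  exists (iota : H -> G) (ipath : H -> H -> seq G),
    graph_embedding iota ipath.

(* Main.v *)
Require Import Defs.
From mathcomp Require Import all_boot all_order all_algebra.
From mathcomp Require Import all_classical all_reals.
From mathcomp Require Import zify ring lra.

(* Call two vertices of U linked if no finite set separates them.  If U contains
   every thickened graph, in which each edge is replaced by infinitely many
   parallel paths, then the linkage relation of U contains, as a subgraph, every
   countable planar graph that can be thickened in the plane; and as finitely
   many linked pairs can be joined by disjoint paths of U, the linkage relation
   of a planar U admits no subdivision of K_{3,3}.

   For A : nat -> bool consider the ladder s_0 s_1 ..., r_0 r_1 ... with rungs
   s_i r_i, an apex a joined to all s_i, an apex b joined to all r_i, and in the
   i-th cell the diagonal s_i r_{i+1} if A i and r_i s_{i+1} otherwise.  Since U is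
   countable, two different A, B have ladders in U with the same a, b, s_0, r_0,
   s_1, r_1.  Absence of K_{3,3} then forces s_i, r_i to agree for all i, and a cell
   where A and B differ receives both diagonals, which creates a K_{3,3}.

   Nonplanarity of K_{3,3} is a parity count: for disjoint polygonal arcs e, f, the
   horizontal rays issued to the right from the ends of e cross f as often,
   modulo 2, as the rays issued to the left from the ends of f cross e.  Adding
   this up over pairs of disjoint edges of K_{3,3} yields 1 = 0. *)

Set Implicit Arguments.
Unset Strict Implicit.
Unset Printing Implicit Defensive.

Import Order.TTheory GRing.Theory Num.Theory.

Local Open Scope classical_set_scope.
Local Open Scope ring_scope.

(** * Ray parity for disjoint segments *)

Section RayParity.
Variable R : realType.
Implicit Types p q w z : 'rV[R]_2.

Definition px p := p 0 0.
Definition py p := p 0 1.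

Definition lexlt p q := (py p < py q) || (py p == py q) && (px p < px q).

Definition orient p q w :=
  (px q - px p) * (py w - py p) - (py q - py p) * (px w - px p).

(* Crossing of the segment [p, q] with the horizontal ray issued from w to the
   right (hitR), resp. to the left (hitL).  Comparing heights lexicographically
   amounts to tilting the ray infinitesimally, so that no ray from another
   point passes through an end of the segment. *)
Definition hitR w p q :=
  if lexlt p w && lexlt w q then 0 < orient p q w
  else if lexlt q w && lexlt w p then orient p q w < 0 else false.

Definition hitL w p q :=
  if lexlt p w && lexlt w q then orient p q w < 0
  else if lexlt q w && lexlt w p then 0 < orient p q w else false.

Lemma point_eq p q : px p = px q -> py p = py q -> p = q.
Proof.
move=> e0 e1; apply/rowP => i; case: (unliftP 0 i) => [j ->|->]; last exact: e0.
by rewrite ord1 (_ : lift 0 0 = 1) //; apply: val_inj.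
Qed.

Lemma segmentE p q z : segment p q z <->
  exists2 t, 0 <= t <= 1 & px z = (1 - t) * px p + t * px q /\
                           py z = (1 - t) * py p + t * py q.
Proof.
split.
  move=> [t /= ht <-]; exists t; first by move: ht; rewrite in_itv.
  by rewrite /px /py !mxE.
move=> [t ht [ex ey]]; exists t; first by rewrite /= in_itv.
by apply: point_eq; rewrite ?ex ?ey /px /py !mxE.
Qed.

Lemma segmentC p q : segment p q = segment q p.
Proof.
apply/seteqP; split=> z /segmentE[t ht [ex ey]]; apply/segmentE;
  exists (1 - t); [lra|split; lra|lra|split; lra].
Qed.

Lemma lexlt_total p q : p <> q -> lexlt p q = ~~ lexlt q p.
Proof.
move=> ne; rewrite /lexlt; case: (ltgtP (py p) (py q)) => //= ey.
case: (ltgtP (px p) (px q)) => //= ex.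
by case: ne; apply: point_eq.
Qed.

Lemma orientC p q w : orient q p w = - orient p q w.
Proof. rewrite /orient; ring. Qed.

Lemma lexlt_asym p q : lexlt p q -> lexlt q p -> False.
Proof.
rewrite /lexlt; case: (ltgtP (py p) (py q)) => //= _.
by case: (ltgtP (px p) (px q)).
Qed.

Lemma hitRC w p q : hitR w q p = hitR w p q.
Proof.
rewrite /hitR orientC oppr_gt0 oppr_lt0.
case: ifP => [/andP[h1 h2]|_]; last by case: ifP.
by case: ifP => // /andP[h3 _]; case: (lexlt_asym h2 h3).
Qed.

Lemma hitLC w p q : hitL w q p = hitL w p q.
Proof.
rewrite /hitL orientC oppr_gt0 oppr_lt0.
case: ifP => [/andP[h1 h2]|_]; last by case: ifP.
by case: ifP => // /andP[h3 _]; case: (lexlt_asym h2 h3).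
Qed.


(** Height in slightly sheared coordinates: for small positive [e] it turns the lexicographic order
    of finitely many points into an order of reals. *)
Definition tilt (e : R) p := py p + e * px p.

Lemma tilt_lexlt_pair p q : exists2 e : R, 0 < e &
  forall e', 0 < e' <= e -> lexlt p q -> tilt e' p < tilt e' q.
Proof.
rewrite /lexlt /tilt; case: (ltgtP (py p) (py q)) => /= hy.
- have a0 := normr_ge0 (px p - px q).
  (* With this bound [e' * (px p - px q)] stays below the gap [py q - py p]. *)
  exists ((py q - py p) / (2 * (1 + `|px p - px q|))).
    by apply: divr_gt0; lra.
  move=> e' /andP[e0 +] _; rewrite ler_pdivlMr; last lra.
  have := ler_wpM2l (ltW e0) (ler_norm (px p - px q)).
  nra.
- by exists 1.
- by exists 1 => // e' /andP[e0 _] hx; rewrite hy ltrD2l ltr_pM2l.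
Qed.

Lemma tilt_lexlt (s : seq ('rV[R]_2 * 'rV[R]_2)) : exists2 e : R, 0 < e &
  forall e', 0 < e' <= e -> forall p q, (p, q) \in s -> lexlt p q ->
    tilt e' p < tilt e' q.
Proof.
elim: s => [|[a b] s [e e0 IH]]; first by exists 1.
have [d d0 Hd] := tilt_lexlt_pair a b.
exists (Num.min d e); first by rewrite lt_min d0.
move=> e' /andP[e'0]; rewrite le_min => /andP[ed ee] p q.
rewrite inE => /orP[/eqP[-> ->]|pq]; first by apply: Hd; rewrite e'0.
by apply: IH; rewrite ?e'0.
Qed.

Lemma tilt_lexltE (s : seq 'rV[R]_2) : exists e : R,
  {in s &, forall p q, p <> q -> tilt e p != tilt e q} /\
  {in s &, forall p q, lexlt p q = (tilt e p < tilt e q)}.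
Proof.
have [e e0 H] := tilt_lexlt (allpairs pair s s).
have {}H p q : p \in s -> q \in s -> lexlt p q -> tilt e p < tilt e q.
  by move=> ps qs; apply: H; rewrite ?e0 ?lexx //; apply/allpairsP; exists (p, q).
exists e; split=> p q ps qs; last first.
  apply/idP/idP; first exact: H.
  case: (eqVneq p q) => [->|/eqP ne]; first by rewrite ltxx.
  rewrite (lexlt_total ne) => h; apply/negP => /(H _ _ qs ps).
  by rewrite ltNge (ltW h).
move=> ne; case E: (lexlt p q); first by rewrite lt_eqF // H.
by rewrite gt_eqF // H // lexlt_total // ?E //; move=> /esym.
Qed.

Lemma orient_tilt e p q w : orient p q w =
  (px q - px p) * (tilt e w - tilt e p) - (tilt e q - tilt e p) * (px w - px p).
Proof. rewrite /orient /tilt; ring. Qed.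

(* A horizontal sweep: two disjoint segments keep their left-right order between
   two common heights. *)
Lemma disjoint_order e p p' q q' (s0 t0 s1 t1 : R) :
  segment p p' `&` segment q q' = set0 ->
  0 <= s0 <= 1 -> 0 <= t0 <= 1 -> 0 <= s1 <= 1 -> 0 <= t1 <= 1 ->
  let X s p p' := (1 - s) * px p + s * px p' in
  let H s p p' := (1 - s) * tilt e p + s * tilt e p' in
  H s0 p p' = H t0 q q' -> H s1 p p' = H t1 q q' ->
  (X s0 p p' < X t0 q q') = (X s1 p p' < X t1 q q').
Proof.
move=> dis hs0 ht0 hs1 ht1 X H e0 e1.
have nomeet s t : 0 <= s <= 1 -> 0 <= t <= 1 -> H s p p' = H t q q' ->
    X s p p' = X t q q' -> False.
  move=> hs ht eH eX.
  have : (segment p p' `&` segment q q') ((1 - s) *: p + s *: p').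
    split; apply/segmentE; first by exists s => //; rewrite /px /py !mxE.
    exists t => //; rewrite -/(X t q q') -eX; split; first by rewrite /px !mxE.
    transitivity (H s p p' - e * X s p p').
      by rewrite /H /X /tilt /px /py !mxE; ring.
    by rewrite eH eX /H /X /tilt; ring.
  by rewrite dis.
have cross s t s' t' : 0 <= s <= 1 -> 0 <= t <= 1 -> 0 <= s' <= 1 ->
    0 <= t' <= 1 -> H s p p' = H t q q' -> H s' p p' = H t' q q' ->
    X s p p' < X t q q' -> X t' q q' <= X s' p p' -> False.
  move=> hs ht hs' ht' eH eH' lt1 lt2.
  pose d0 := X t q q' - X s p p'; pose d1 := X s' p p' - X t' q q'.
  have dpos : 0 < d0 + d1 by rewrite /d0 /d1; lra.
  (* The zero of the affine interpolation between the horizontal gaps [d0] and [- d1]; there the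
     segments would meet. *)
  pose l := d0 / (d0 + d1).
  have l01 : 0 <= l <= 1.
    by rewrite /l divr_ge0 ?ler_pdivrMr // /d0 /d1; lra.
  have lE : l * (d0 + d1) = d0 by rewrite /l divfK // gt_eqF.
  apply: (nomeet ((1 - l) * s + l * s') ((1 - l) * t + l * t')).
  - by apply/andP; split; nra.
  - by apply/andP; split; nra.
  - transitivity ((1 - l) * H s p p' + l * H s' p p'); first by rewrite /H; ring.
    by rewrite eH eH' /H; ring.
  - transitivity ((1 - l) * X s p p' + l * X s' p p'); first by rewrite /X; ring.
    transitivity ((1 - l) * X t q q' + l * X t' q q'); last by rewrite /X; ring.
    move: lE; rewrite /d0 /d1; lra.
case: ltP => h1; case: ltP => h2 //; exfalso.
  exact: (cross s0 t0 s1 t1).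
exact: (cross s1 t1 s0 t0).
Qed.


(** [orient] is the positive height [tilt e q' - tilt e q] times the signed horizontal distance from
    [w] to the point of the segment level with [w]. *)
Lemma orient_foot e q q' w : tilt e q < tilt e w < tilt e q' ->
  exists t : R, [/\ 0 <= t <= 1, tilt e w = (1 - t) * tilt e q + t * tilt e q',
    (0 < orient q q' w) = (px w < (1 - t) * px q + t * px q') &
    (orient q q' w < 0) = ((1 - t) * px q + t * px q' < px w)].
Proof.
move=> /andP[h1 h2]; have d0 : 0 < tilt e q' - tilt e q by lra.
pose t := (tilt e w - tilt e q) / (tilt e q' - tilt e q).
have tE : t * (tilt e q' - tilt e q) = tilt e w - tilt e q.
  by rewrite /t divfK // gt_eqF.
have oE : orient q q' w =
    (tilt e q' - tilt e q) * ((1 - t) * px q + t * px q' - px w).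
  by rewrite (orient_tilt e) -tE; ring.
exists t; split.
- by apply/andP; split; nra.
- by move: tE; lra.
- by rewrite oE pmulr_rgt0 // subr_gt0.
- by rewrite oE pmulr_rlt0 // subr_lt0.
Qed.

Lemma hit_refl w p : hitR w p p = false /\ hitL w p p = false.
Proof.
have E : lexlt p w && lexlt w p = false.
  by apply/negP => /andP[h1 h2]; case: (lexlt_asym h1 h2).
by rewrite /hitR /hitL E.
Qed.

(** A ray counts only if its origin has height between the ends of the other segment. If the height
    ranges overlap, this holds for exactly two ends, those bounding the common range. Both then ask
    whether [p p'] is to the left of [q q'], and by [disjoint_order] the answers agree. *)
Lemma hit_disjoint p p' q q' : segment p p' `&` segment q q' = set0 ->
  hitR p q q' (+) hitR p' q q' (+) hitL q p p' (+) hitL q' p p' = false.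
Proof.
move=> dis.
wlog pp' : p p' dis / lexlt p p' => [H|].
  case: (eqVneq p p') => [->|/eqP ne].
    by rewrite !(hit_refl _ p').2 !addbF addbb.
  case E: (lexlt p p'); first exact: H.
  rewrite -!(hitLC _ p p') (addbC (hitR p q q')); apply: H; first by rewrite segmentC.
  by rewrite lexlt_total ?E //; apply: nesym.
wlog qq' : q q' dis / lexlt q q' => [H|].
  case: (eqVneq q q') => [->|/eqP ne].
    by rewrite !(hit_refl _ q').1 -addbA !addbb.
  case E: (lexlt q q'); first exact: H.
  rewrite -!(hitRC _ q q') -addbA (addbC (hitL q p p')) addbA; apply: H.
    by rewrite (segmentC q').
  by rewrite lexlt_total ?E //; apply: nesym.
have [e [hne hlt]] := tilt_lexltE [:: p; p'; q; q'].
have inP : [/\ p \in [:: p; p'; q; q'], p' \in [:: p; p'; q; q'],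
   q \in [:: p; p'; q; q'] & q' \in [:: p; p'; q; q']].
  by split; rewrite !inE eqxx ?orbT.
case: inP => ip ip' iq iq'.
have ends (a b : 'rV[R]_2) : segment a b a /\ segment a b b.
  by split; apply/segmentE; [exists 0|exists 1]; rewrite ?lexx ?ler01 //
    ?subrr ?subr0 ?mul0r ?mul1r ?addr0 ?add0r.
have dne a b : segment p p' a -> segment q q' b -> a <> b.
  by move=> ha hb eab; have : (segment p p' `&` segment q q') a;
    [split=> //; rewrite eab|rewrite dis].
have [ep ep'] := ends p p'; have [eq_ eq_'] := ends q q'.
have n1 := hne _ _ ip iq (dne _ _ ep eq_).
have n2 := hne _ _ ip iq' (dne _ _ ep eq_').
have n3 := hne _ _ ip' iq (dne _ _ ep' eq_).
have n4 := hne _ _ ip' iq' (dne _ _ ep' eq_').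
rewrite /hitR /hitL !hlt //; move: pp' qq'; rewrite !hlt // => pp' qq'.
have ord := @disjoint_order e p p' q q' _ _ _ _ dis.
have H01 : 0 <= (0 : R) <= 1 by rewrite lexx ler01.
have H11 : 0 <= (1 : R) <= 1 by rewrite lexx ler01.
have footP w : tilt e p < tilt e w < tilt e p' -> exists t : R, [/\ 0 <= t <= 1, 
    (1 - t) * tilt e p + t * tilt e p' = tilt e w &
    (orient p p' w < 0) = ((1 - t) * px p + t * px p' < px w)].
  by case/orient_foot=> t [h1 h2 h3 h4]; exists t.
have footQ w : tilt e q < tilt e w < tilt e q' -> exists t : R, [/\ 0 <= t <= 1, 
    tilt e w = (1 - t) * tilt e q + t * tilt e q' &
    (0 < orient q q' w) = (px w < (1 - t) * px q + t * px q')].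
  by case/orient_foot=> t [h1 h2 h3 h4]; exists t.
have E0 (a b : R) : (1 - 0) * a + 0 * b = a by ring.
have E1 (a b : R) : (1 - 1) * a + 1 * b = b by ring.
have nlt (x y : R) : x < y -> (y < x) = false by move=> h; rewrite ltNge ltW.
clear dis dne ends ep ep' eq_ eq_' hne hlt ip ip' iq iq'.
(* Two interleaved and two nested orders of the four heights survive. *)
case: (ltgtP (tilt e p) (tilt e q)) n1 => // l1 _;
case: (ltgtP (tilt e p) (tilt e q')) n2 => // l2 _;
case: (ltgtP (tilt e p') (tilt e q)) n3 => // l3 _;
case: (ltgtP (tilt e p') (tilt e q')) n4 => // l4 _; rewrite /= ?addbF ?addFb //;
try by [exfalso; clear -pp' qq' l1 l2 l3 l4; lra].
- have [t [t1 t2 ->]] := footQ p' ltac:(by rewrite l3 l4).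
  have [s [s1 s2 ->]] := footP q ltac:(by rewrite l1 l3).
  have := ord s 0 1 t s1 H01 H11 t1; rewrite /= !(E0, E1) => -> //.
  by rewrite addbb.
- have [t [t1 t2 ->]] := footP q' ltac:(by rewrite l2 l4).
  have [s [s1 s2 ->]] := footP q ltac:(by rewrite l1 l3).
  have := ord s 0 t 1 s1 H01 t1 H11; rewrite /= !(E0, E1) => -> //.
  by rewrite addbb.
- have [t [t1 t2 ->]] := footQ p' ltac:(by rewrite l3 l4).
  have [s [s1 s2 ->]] := footQ p ltac:(by rewrite l1 l2).
  have := ord 0 s 1 t H01 s1 H11 t1; rewrite /= !(E0, E1) => -> //.
  by rewrite addbb.
- have [t [t1 t2 ->]] := footP q' ltac:(by rewrite l2 l4).
  have [s [s1 s2 ->]] := footQ p ltac:(by rewrite l1 l2).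
  have := ord 0 s t 1 H01 s1 t1 H11; rewrite /= !(E0, E1) => -> //.
  by rewrite addbb.
Qed.

End RayParity.

(** * Nonplanarity of K33 *)

Section WalkSum.

Fixpoint walk_sum (T : Type) (f : T -> T -> bool) (x : T) (s : seq T) : bool :=
  if s is y :: s' then f x y (+) walk_sum f y s' else false.

Lemma walk_sum_sep (T : Type) (e : rel T) (f g : T -> T -> bool) (h : T -> bool)
    x s :
  (forall p q, e p q -> f p q (+) g p q = h p (+) h q) -> path e x s ->
  walk_sum f x s (+) walk_sum g x s = h x (+) h (last x s).
Proof.
move=> H; elim: s x => [|y s IH] x /=; first by rewrite addbb.
move=> /andP[/H h1 /IH h2].
by rewrite addbACA h1 h2 addbA -(addbA (h x)) addbb addbF.
Qed.

(* Discrete Green formula: the hypothesis says that a sum of boundary terms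
   vanishes on each square (p, p') x (q, q') of a product of two walks. *)
Lemma walk_sum_boundary (S T : Type) (e1 : rel S) (e2 : rel T)
    (f : S -> T -> T -> bool) (g : T -> S -> S -> bool) x s y t :
  (forall p p' q q', e1 p p' -> e2 q q' ->
    f p q q' (+) f p' q q' (+) g q p p' (+) g q' p p' = false) ->
  path e1 x s -> path e2 y t ->
  walk_sum (f x) y t (+) walk_sum (f (last x s)) y t
  (+) walk_sum (g y) x s (+) walk_sum (g (last y t)) x s = false.
Proof.
move=> H + pt.
have row p p' : e1 p p' -> walk_sum (f p) y t (+) walk_sum (f p') y t
    (+) g y p p' (+) g (last y t) p p' = false.
  move=> epp; elim: t y pt => [|z t IH] y /=; first by rewrite addbb.
  move=> /andP[eyz /IH]; move: (H _ _ _ _ epp eyz).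
  move: (f p y z) (f p' y z) (g y p p') (g z p p') (g _ p p').
  by move: (walk_sum _ _ _) (walk_sum _ _ _); do 7!case.
elim: s x => [|z s IH] x /=; first by rewrite addbb.
move=> /andP[exz /IH]; move: (row _ _ exz).
move: (g y x z) (g (last y t) x z) (walk_sum (f _) _ _) (walk_sum (f z) _ _).
move: (walk_sum (f _) _ _) (walk_sum (g _) _ _) (walk_sum (g _) _ _).
by do 7!case.
Qed.

End WalkSum.

(** The tilted line through [w] meets the segment exactly when it separates the ends, and then on
    exactly one side of [w], as [w] is off the segment. *)
Lemma hit_sep (R : realType) (w p q : 'rV[R]_2) : ~ segment p q w ->
  hitR w p q (+) hitL w p q = lexlt p w (+) lexlt q w.
Proof.
move=> nw.
have nwp : p <> w.
  move=> e; apply: nw; apply/segmentE; rewrite -e; exists 0; first by lra.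
  by rewrite subr0 !mul1r !mul0r !addr0.
have nwq : q <> w.
  move=> e; apply: nw; apply/segmentE; rewrite -e; exists 1; first by lra.
  by rewrite subrr !mul1r !mul0r !add0r.
have on a b : (forall z, segment a b z -> segment p q z) ->
    lexlt a w -> lexlt w b -> orient a b w = 0 -> False.
  move=> sub h1 h2 o0.
  have [e [_ hlt]] := tilt_lexltE [:: a; b; w].
  have [] := @orient_foot _ e a b w.
    by rewrite -!hlt ?inE ?eqxx ?orbT // h1 h2.
  move=> t [t1 t2]; rewrite o0 ltxx => /esym/negbT h3 /esym/negbT h4.
  have ex : px w = (1 - t) * px a + t * px b by move: h3 h4; rewrite -!leNgt; lra.
  apply: nw; apply: sub; apply/segmentE; exists t => //; split=> //.
  have -> : py w = tilt e w - e * px w by rewrite /tilt; ring.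
  by rewrite t2 ex /tilt; ring.
rewrite /hitR /hitL (lexlt_total nwq) (lexlt_total (nesym nwp)).
case hp: (lexlt p w); case hq: (lexlt w q) => //=.
  have := on p q (fun z h => h) hp hq.
  by case: (ltgtP 0 (orient p q w)) => // <- [].
have hw : lexlt w p by rewrite (lexlt_total (nesym nwp)) hp.
have hq' : lexlt q w by rewrite (lexlt_total nwq) hq.
have := on q p _ hq' hw; rewrite segmentC => /(_ (fun z h => h)).
rewrite orientC.
by case: (ltgtP 0 (orient p q w)) => // <-; rewrite oppr0; case.
Qed.

Lemma path_with (T : eqType) (e : rel T) (P : {pred T}) x s :
  path e x s -> {subset x :: s <= P} ->
  path (fun u v => [&& e u v, u \in P & v \in P]) x s.
Proof.
elim: s x => //= y s IH x /andP[-> pys] sub.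
rewrite !sub ?inE ?eqxx ?orbT //=; apply: IH => // z zs.
by apply: sub; rewrite inE zs orbT.
Qed.

Lemma chain_sides (R : realType) (x : 'rV[R]_2) s (A : set 'rV[R]_2) :
  chain_support (x :: s) `<=` A ->
  path (fun p q => `[< segment p q `<=` A >]) x s.
Proof.
elim: s x => //= y s IH x sub; apply/andP; split.
  by apply/asboolP => z xyz; apply: sub; exists 0%N.
apply: IH => z [i /= hi hz]; apply: sub; by exists i.+1.
Qed.

(** * Crossing parities in a plane drawing *)

Section PlaneDrawing.
Variables (R : realType) (U : sgraph) (pos : U -> 'rV[R]_2).
Variable arc : U -> U -> set 'rV[R]_2.
Hypothesis emb : plane_embedding pos arc.

Lemma chain_of_arc : exists ch : U -> U -> seq 'rV[R]_2,
  forall u v, edge u v -> last (pos u) (ch u v) = pos v /\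
    path (fun p q => `[< segment p q `<=` arc u v >]) (pos u) (ch u v).
Proof.
have H (uv : U * U) : exists s : seq 'rV[R]_2, edge uv.1 uv.2 ->
    last (pos uv.1) s = pos uv.2 /\
    path (fun p q => `[< segment p q `<=` arc uv.1 uv.2 >]) (pos uv.1) s.
  case: uv => u v /=; have [euv|] := boolP (edge u v); last by exists [::].
  have [s [+ + + _ ->]] := arc_polygonal emb euv.
  case: s => [|x [|y s]] //= _ <- <-.
  by exists (y :: s) => _; split=> //; exact: (@chain_sides _ x (y :: s)).
have [ch Hch] := choice H.
by exists (fun u v => ch (u, v)) => u v euv; apply: (Hch (u, v)).
Qed.

(** All that is retained of the drawing: [r w u v] and [l w u v] are the parities of the crossings
    of the arc [uv] with the right and left rays from [w]. *)
Lemma drawing_parity : exists r l : U -> U -> U -> bool,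
  (forall w u v, edge u v -> w != u -> w != v ->
    r w u v (+) l w u v = lexlt (pos u) (pos w) (+) lexlt (pos v) (pos w)) /\
  (forall u v u' v', edge u v -> edge u' v' ->
    u != u' -> u != v' -> v != u' -> v != v' ->
    r u u' v' (+) r v u' v' (+) l u' u v (+) l v' u v = false).
Proof.
have [ch Hch] := chain_of_arc.
exists (fun w u v => walk_sum (hitR (pos w)) (pos u) (ch u v)).
exists (fun w u v => walk_sum (hitL (pos w)) (pos u) (ch u v)).
split.
  move=> w u v euv wu wv; have [<- pth] := Hch _ _ euv.
  apply: (@walk_sum_sep _ _ _ _ (fun a => lexlt a (pos w)) _ _ _ pth).
  move=> p q /asboolP sub; apply: hit_sep => /sub ha.
  by case: (arc_vertex emb euv ha) => e; rewrite e eqxx in wu wv.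
move=> u v u' v' e1 e2 n1 n2 n3 n4.
have [l1 p1] := Hch _ _ e1; have [l2 p2] := Hch _ _ e2.
have := walk_sum_boundary _ p1 p2.
move=> /(_ (@hitR R) (@hitL R)); rewrite l1 l2; apply.
move=> p p' q q' /asboolP s1 /asboolP s2; apply: hit_disjoint.
apply/seteqP; split=> // z [/s1 a1 /s2 a2].
(* Arcs of disjoint edges share no point: [arc_vertex] excludes the ends, [arc_disjoint] the other
   points. *)
have [ns|] := pselect ((pos u = z \/ pos v = z) \/ (pos u' = z \/ pos v' = z)).
  case: ns => [] [] e; rewrite -e in a1 a2.
  - by case: (arc_vertex emb e2 a2) => h; rewrite h eqxx in n1 n2.
  - by case: (arc_vertex emb e2 a2) => h; rewrite h eqxx in n3 n4.
  - by case: (arc_vertex emb e1 a1) => h; rewrite h eqxx in n1 n3.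
  - by case: (arc_vertex emb e1 a1) => h; rewrite h eqxx in n2 n4.
move=> nz; have : ~~ same_edge u v u' v'.
  by rewrite /same_edge (negPf n1) (negPf n2).
move=> /(arc_disjoint emb e1 e2) <-; split; split=> //= -[] e; apply: nz;
  by [left; left|left; right|right; left|right; right].
Qed.

End PlaneDrawing.

(** * Sums modulo 2 over the off-diagonal pairs of ['I_3] *)

Section OffDiagonalSum.
Implicit Types F G : 'I_3 -> 'I_3 -> bool.

Let o0 : 'I_3 := @Ordinal 3 0 isT.
Let o1 : 'I_3 := @Ordinal 3 1 isT.
Let o2 : 'I_3 := @Ordinal 3 2 isT.

Definition offdiag_sum F := F o0 o1 (+) F o0 o2 (+) F o1 o0 (+) F o1 o2
  (+) F o2 o0 (+) F o2 o1.

Lemma eq_offdiag F G : (forall j l, j != l -> F j l = G j l) ->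
  offdiag_sum F = offdiag_sum G.
Proof. by move=> H; rewrite /offdiag_sum !H. Qed.

Lemma offdiag_add F G :
  offdiag_sum (fun j l => F j l (+) G j l) = offdiag_sum F (+) offdiag_sum G.
Proof.
by rewrite /offdiag_sum; apply/esym; do 5!(rewrite [LHS]addbACA; congr (_ (+) _)).
Qed.

Lemma offdiag_swap F : offdiag_sum (fun j l => F l j) = offdiag_sum F.
Proof.
rewrite /offdiag_sum.
move: (F o0 o1) (F o0 o2) (F o1 o0) (F o1 o2) (F o2 o0) (F o2 o1).
by do 6!case.
Qed.

Lemma offdiag_fst (f : 'I_3 -> bool) : offdiag_sum (fun j _ => f j) = false.
Proof. by rewrite /offdiag_sum; move: (f o0) (f o1) (f o2); do 3!case. Qed.

Lemma offdiag_snd (f : 'I_3 -> bool) : offdiag_sum (fun _ l => f l) = false.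
Proof. by rewrite (offdiag_swap (fun j _ => f j)) offdiag_fst. Qed.

(** Each of the three unordered pairs contributes exactly one, and three is odd. *)
Lemma offdiag_tournament F : (forall j l, j != l -> F j l = ~~ F l j) ->
  offdiag_sum F = true.
Proof.
move=> H; rewrite /offdiag_sum (H o1 o0) // (H o2 o0) // (H o2 o1) //.
by move: (F o0 o1) (F o0 o2) (F o1 o2); do 3!case.
Qed.

Lemma odd_triangle (f : 'I_3 -> bool) :
  (forall i k, i != k -> f i (+) f k = true) -> False.
Proof.
move=> H; move: (H o0 o1 isT) (H o1 o2 isT) (H o0 o2 isT).
by move: (f o0) (f o1) (f o2); do 3!case.
Qed.

End OffDiagonalSum.

(* For i <> k, add up over all j <> l the boundary relations of the pairs of
   disjoint walks (P i j, P k l): what remains is a 2-colouring of a triangle. *)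
Lemma K33_nonplanar (R : realType) (U : sgraph) (x y : 'I_3 -> U)
    (P : 'I_3 -> 'I_3 -> seq U) :
  planar R U ->
  (forall i j, path edge (x i) (P i j) /\ last (x i) (P i j) = y j) ->
  (forall i j k l z, i != k -> j != l ->
     z \in x i :: P i j -> z \in x k :: P k l -> False) ->
  False.
Proof.
move=> [pos [arc emb]] walk dis.
have [r [l [sep bnd]]] := drawing_parity emb.
pose lt u v := lexlt (pos u) (pos v).
pose rP w i j := walk_sum (r w) (x i) (P i j).
pose lP w i j := walk_sum (l w) (x i) (P i j).
have xP i j : x i \in x i :: P i j by rewrite inE eqxx.
have yP i j : y j \in x i :: P i j by rewrite -(walk i j).2 mem_last.
have edP i j : path (fun u v => [&& edge u v, u \in x i :: P i j
    & v \in x i :: P i j]) (x i) (P i j).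
  by apply: path_with (walk i j).1 _.
(* [sep] trades left crossings for right ones at the price of order terms. *)
have lPE w i j : w \notin x i :: P i j ->
    lP w i j = rP w i j (+) lt (x i) w (+) lt (y j) w.
  move=> wn; rewrite -addbA -{1}(walk i j).2.
  rewrite -(@walk_sum_sep _ _ (r w) (l w) (lt^~ w) _ _ _ (edP i j)) ?addbA ?addbb //.
  move=> u v /and3P[euv uP vP]; apply: sep => //.
    by apply: contraNneq wn => ->.
  by apply: contraNneq wn => ->.
have star i k j m : i != k -> j != m ->
    rP (x i) k m (+) rP (y j) k m (+) lP (x k) i j (+) lP (y m) i j = false.
  move=> ik jm.
  have := walk_sum_boundary _ (edP i j) (edP k m).
  move=> /(_ r l); rewrite (walk i j).2 (walk k m).2; apply.
  move=> p p' q q' /and3P[e1 pP p'P] /and3P[e2 qP q'P].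
  have ne a b : a \in x i :: P i j -> b \in x k :: P k m -> a != b.
    by move=> + hb; apply: contraTneq => ->; apply/negP => /(dis i j k m _ ik jm) /(_ hb).
  by apply: bnd => //; apply: ne.
pose Q m := offdiag_sum (fun j k => rP (y j) m k).
apply: (@odd_triangle Q) => i k ik.
rewrite addbC /Q -(offdiag_swap (fun j m => rP (y j) i m)) -offdiag_add.
(* Every term but [lt (y j) (y m)] depends on at most one of [j], [m] and cancels in the sum; the
   remaining one is a tournament. *)
transitivity (offdiag_sum (fun j m => rP (x i) k m (+) lt (x i) (y m) (+)
  (rP (x k) i j (+) lt (y j) (x k)) (+) (lt (x i) (x k) (+) lt (y j) (y m)))).
  apply: eq_offdiag => j m jm; move: (star i k j m ik jm); rewrite !lPE.
  - move: (rP _ _ _) (rP _ _ _) (rP _ _ _) (rP _ _ _) (lt _ _) (lt _ _) (lt _ _) (lt _ _).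
    by do 8!case.
  - by apply/negP => /(dis i j k m _ ik jm); apply.
  - by apply/negP => /(dis i j k m _ ik jm); apply.
rewrite !offdiag_add !offdiag_fst !offdiag_snd /= offdiag_tournament //.
move=> j m jm; apply: lexlt_total => /(pos_inj emb) e.
by apply: (dis i j k m (y j)) => //; rewrite e.
Qed.

(** * Linked vertices *)

Section Linked.
Variable U : sgraph.
Implicit Types (x y z : U) (L p q : seq U).

(* By Menger, this amounts to infinitely many internally disjoint x--y paths
   (or an edge xy, or x = y). *)
Definition linked x y : Prop := forall L, exists p,
  [/\ path edge x p, last x p = y & forall z, z \in p -> z \in L -> z \in [:: x; y]].

Lemma linked_sym x y : linked x y -> linked y x.
Proof.
move=> H L; have [p [pp lp Hp]] := H L; exists (rev (belast x p)).
have mem z : z \in rev (belast x p) -> z \in x :: p.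
  by rewrite mem_rev => /mem_belast.
split.
- by rewrite -lp rev_path; apply: sub_path pp => u v; rewrite edge_sym.
- case: (p) lp => [|u s] //= lp.
  by rewrite rev_cons last_rcons.
- move=> z /mem; rewrite inE => /predU1P[->|zp zL]; first by rewrite !inE eqxx orbT.
  by have := Hp z zp zL; rewrite !inE orbC.
Qed.

(** Each step is replaced by a path of [U] avoiding [L] except at the ends of the step. The result
    is a walk, which is what [K33_nonplanar] takes. *)
Lemma linked_walk x p L : path (fun u v => `[< linked u v >]) x p ->
  exists q, [/\ path edge x q, last x q = last x p &
    forall z, z \in q -> z \in L -> z \in x :: p].
Proof.
elim: p x => [|y p IH] x /=; first by exists [::].
move=> /andP[/asboolP /(_ L)[q1 [p1 l1 h1]] /IH[q2 [p2 l2 h2]]].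
exists (q1 ++ q2); split.
- by rewrite cat_path p1 l1.
- by rewrite last_cat l1.
- move=> z; rewrite mem_cat => /orP[/h1 h /h|/h2 h /h]; rewrite !inE.
    by case/orP => ->; rewrite ?orbT.
  by move=> ->; rewrite orbT.
Qed.

(** Greedy construction: each new walk avoids [V0] and all walks already built, except at its own
    prescribed vertices. *)
Lemma linked_walks (I : eqType) (s : seq I) (x : I -> U) (P : I -> seq U) (V0 : seq U) :
  (forall i, i \in s -> path (fun u v => `[< linked u v >]) (x i) (P i)) ->
  (forall i, i \in s -> {subset x i :: P i <= V0}) ->
  exists Q : I -> seq U,
    (forall i, i \in s -> [/\ path edge (x i) (Q i), last (x i) (Q i) = last (x i) (P i)
       & forall z, z \in Q i -> z \in V0 -> z \in x i :: P i]) /\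
    (forall i j z, i \in s -> j \in s -> i != j -> z \in Q i -> z \in Q j -> z \in V0).
Proof.
elim: s => [|i s IH] lk sub; first by exists P.
have [||Q [Q1 Q2]] := IH.
- by move=> j js; apply: lk; rewrite inE js orbT.
- by move=> j js; apply: sub; rewrite inE js orbT.
have i0 : i \in i :: s by rewrite inE eqxx.
have [q [q1 q2 q3]] := linked_walk (V0 ++ flatten [seq Q j | j <- s]) (lk i i0).
exists (fun j => if j == i then q else Q j); split.
  move=> j; rewrite inE; case: eqVneq => [-> _|_ /= /Q1 //].
  by split=> // z zq zV; apply: q3; rewrite // mem_cat zV.
have key j z : j \in s -> z \in q -> z \in Q j -> z \in V0.
  move=> js zq zQ; apply: (sub i i0); apply: q3 => //.
  by rewrite mem_cat; apply/orP; right; apply/flattenP; exists (Q j); rewrite ?map_f.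
move=> j k z; rewrite !inE; case: (eqVneq j i) => [->|ji] /=;
  case: (eqVneq k i) => [->|ki] //=; rewrite ?eqxx //.
- by move=> _ ks _; apply: key.
- by move=> js _ _ zQ zq; apply: (key j).
- exact: Q2.
Qed.

(** A certificate for [K_{3,3}], checked by computation. Vertices are positions in a list, [xs] and
    [ys] are the two sides, [P] holds the nine walks without their first vertices, and [E] lists the
    pairs that must be linked. *)
Definition K33_check (n : nat) (xs ys : seq nat) (P : seq (seq (seq nat)))
    (E : seq (nat * nat)) : bool :=
  let W i j := nth 0%N xs i :: nth [::] (nth [::] P i) j in
  all (fun i => all (fun j =>
    [&& path (fun a b => ((a, b) \in E) || ((b, a) \in E)) (nth 0%N xs i)
          (nth [::] (nth [::] P i) j),
        last (nth 0%N xs i) (nth [::] (nth [::] P i) j) == nth 0%N ys j,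
        all (fun a => a < n)%N (W i j) &
        all (fun k => all (fun l => [|| i == k, j == l |
          ~~ has (fun a => a \in W i j) (W k l)]) (iota 0 3)) (iota 0 3)])
    (iota 0 3)) (iota 0 3).

(** The nine walks are realised in [U] with [c] as the reserved set. A common vertex of two of them
    lies in [c], hence on both walks of the certificate, which are disjoint where required. *)
Lemma K33_linked (R : realType) (c : seq U) (x0 : U) xs ys P E :
  planar R U -> uniq c -> K33_check (size c) xs ys P E ->
  foldr (fun ab Q => linked (nth x0 c ab.1) (nth x0 c ab.2) /\ Q) True E -> False.
Proof.
move=> plU uc chk linkE.
have lk a b : (a, b) \in E -> linked (nth x0 c a) (nth x0 c b).
  elim: E linkE {chk} => //= ab E IH [h /IH{}IH].
  by rewrite inE => /predU1P[eab|//]; rewrite -eab in h.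
pose W i j := nth [::] (nth [::] P i) j.
have {}chk (i j : 'I_3) : [/\
    path (fun a b => ((a, b) \in E) || ((b, a) \in E)) (nth 0%N xs i) (W i j),
    last (nth 0%N xs i) (W i j) = nth 0%N ys j,
    (forall a, a \in nth 0%N xs i :: W i j -> (a < size c)%N) &
    forall (k l : 'I_3) a, i != k -> j != l -> a \in nth 0%N xs i :: W i j ->
      a \in nth 0%N xs k :: W k l -> False].
  have mi (m : 'I_3) : (m : nat) \in iota 0 3 by rewrite mem_iota ltn_ord.
  move: chk => /allP /(_ i (mi i)) /allP /(_ j (mi j)) /and4P[h1 /eqP h2 /allP h3 h4].
  split=> // k l a ik jl ha hb.
  move: h4 => /allP /(_ k (mi k)) /allP /(_ l (mi l)).
  rewrite -!val_eqE /= in ik jl; rewrite (negPf ik) (negPf jl) !orFb.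
  by rewrite -all_predC => /allP /(_ a hb) /=; rewrite ha.
pose x (i : 'I_3) := nth x0 c (nth 0%N xs i).
pose y (j : 'I_3) := nth x0 c (nth 0%N ys j).
pose PW (ij : 'I_3 * 'I_3) := map (nth x0 c) (W ij.1 ij.2).
have V0P (ij : 'I_3 * 'I_3) : {subset x ij.1 :: PW ij <= c}.
  move=> z; rewrite -[x _ :: _]/(map (nth x0 c) (nth 0%N xs ij.1 :: W ij.1 ij.2)).
  move=> /mapP[a ha ->]; apply: mem_nth.
  by have [_ _ h _] := chk ij.1 ij.2; apply: h.
have lkP (ij : 'I_3 * 'I_3) : path (fun u v => `[< linked u v >]) (x ij.1) (PW ij).
  rewrite /PW /x path_map; have [h _ _ _] := chk ij.1 ij.2.
  apply: sub_path h => a b /orP[] /lk h; apply/asboolP => //.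
  exact: linked_sym.
have [Q [Q1 Q2]] := @linked_walks _ (enum {: 'I_3 * 'I_3}) (fun ij => x ij.1) PW c
   (fun i _ => lkP i) (fun i _ => V0P i).
have {}Q1 ij := Q1 ij (mem_enum _ ij).
have {}Q2 i j z := Q2 i j z (mem_enum _ i) (mem_enum _ j).
apply: (@K33_nonplanar R U x y (fun i j => Q (i, j)) plU).
  move=> i j; have [h1 h2 _] := Q1 (i, j); split=> //; rewrite h2.
  by rewrite /x /= last_map; have [_ -> _ _] := chk i j.
move=> i j k l z ik jl.
have back m n : z \in x m :: Q (m, n) -> z \in c -> z \in x m :: PW (m, n).
  rewrite inE => /predU1P[->|zQ zc]; first by rewrite inE eqxx.
  by have [_ _ h] := Q1 (m, n); apply: h.
move=> z1 z2.
have zc : z \in c.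
  move: z1 z2; rewrite !inE => /predU1P[-> _|z1 /predU1P[->|z2]].
  - by apply: (V0P (i, j)); rewrite inE eqxx.
  - by apply: (V0P (k, l)); rewrite inE eqxx.
  - apply: Q2 z1 z2; by apply: contraNneq ik => -[->].
have := back _ _ z1 zc; have := back _ _ z2 zc; rewrite /x /PW /=.
rewrite -!(map_cons (nth x0 c)) => /mapP[b hb eb] /mapP[a ha ea].
have [_ _ ca h] := chk i j; have [_ _ cb _] := chk k l.
apply: (h k l a ik jl ha).
suff -> : a = b by [].
by apply/eqP; rewrite -(nth_uniq x0 (ca _ ha) (cb _ hb) uc) -ea -eb.
Qed.

End Linked.

(** The relation [e] carries along a property of the traversed edges. *)
Lemma embedded_walk (H U : sgraph) (iota : H -> U) (ipath : H -> H -> seq U)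
    (e : rel H) (x : H) (p : seq H) :
  graph_embedding iota ipath -> path (fun u v => edge u v && e u v) x p ->
  exists q : seq U, [/\ path edge (iota x) q, last (iota x) q = iota (last x p) &
    forall z, z \in q -> exists u v, [/\ u \in x :: p, v \in x :: p, edge u v,
      e u v & z \in ipath u v]].
Proof.
move=> emb; elim: p x => [|y p IH] x /=; first by exists [::].
move=> /andP[/andP[xy exy] /IH[q2 [p2 l2 h2]]].
have [s1 es1 [p1 l1 _]] := ipath_path emb xy.
exists (s1 ++ q2); split.
- by rewrite cat_path p1 l1.
- by rewrite last_cat l1.
- move=> z; rewrite mem_cat => /orP[zs|/h2[u [v [h3 h4 h5 h6 h7]]]].
    by exists x, y; rewrite !inE !eqxx orbT es1 inE zs orbT.
  by exists u, v; rewrite !(in_cons x) h3 h4 !orbT.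
Qed.

(** The strands become walks of [U] meeting pairwise only at the two ends, so a finite [L] cannot
    obstruct them all. As no strand uses an edge with both ends in [[:: x; y]], distinct strands
    share no edge. *)
Lemma linked_of_strands (H U : sgraph) (iota : H -> U) (ipath : H -> H -> seq U)
    (x y : H) (s : nat -> seq H) :
  graph_embedding iota ipath ->
  (forall k, path (fun u v => edge u v && ~~ ((u \in [:: x; y]) && (v \in [:: x; y])))
     x (s k) /\ last x (s k) = y) ->
  (forall k k' z, k != k' -> z \in x :: s k -> z \in x :: s k' -> z \in [:: x; y]) ->
  linked (iota x) (iota y).
Proof.
move=> emb sP sD.
have [q Hq] := choice (fun k => embedded_walk emb (sP k).1).
have disj k k' z : k != k' -> z \in q k -> z \in q k' -> z \in [:: iota x; iota y].
  move=> kk'.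
  have [_ _ h] := Hq k => /h[u [v [us vs euv nuv zuv]]].
  have [_ _ h'] := Hq k' => /h'[u' [v' [us' vs' euv' nuv' zuv']]].
  have ns : ~~ same_edge u v u' v'.
    apply: contraNN nuv => /orP[] /andP[/eqP e1 /eqP e2]; subst u' v'.
      by rewrite (sD _ _ _ kk' us us') (sD _ _ _ kk' vs vs').
    by rewrite (sD _ _ _ kk' us vs') (sD _ _ _ kk' vs us').
  have back w : w \in [:: x; y] -> iota w \in [:: iota x; iota y].
    by rewrite !inE => /orP[] /eqP ->; rewrite eqxx ?orbT.
  have c1 w : (w == u) || (w == v) -> iota w \in ipath u' v' -> w \in [:: x; y].
    move=> hw /(ipath_vertex emb euv') hw'; apply: (sD _ _ _ kk').
      by case/orP: hw => /eqP ->.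
    by case: hw' => ->.
  have c2 w : (w == u') || (w == v') -> iota w \in ipath u v -> w \in [:: x; y].
    move=> hw' /(ipath_vertex emb euv) hw; apply: (sD _ _ _ kk').
      by case: hw => ->.
    by case/orP: hw' => /eqP ->.
  (* A vertex common to the paths of two distinct edges is the image of an end of one of them; lying
     on the other path too, that end belongs to both strands. *)
  have := ipath_disjoint emb euv euv' ns zuv zuv'.
  rewrite -mem_cat => /= zin.
  have {zin} : [|| z == iota u, z == iota v, z == iota u' | z == iota v'].
    by move: zin; rewrite !inE.
  case/or4P => /eqP ez; rewrite ez; apply: back; [apply: c1|apply: c1|apply: c2|apply: c2];
    by rewrite ?eqxx ?orbT // -ez.
move=> L; apply: contrapT => noL.
have /choice[f Hf] : forall k, exists w,
    [/\ w \in q k, w \in L & w \notin [:: iota x; iota y]].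
  move=> k.
  apply: contrapT => none; apply: noL; exists (q k).
  have [h1 h2 _] := Hq k; split=> //; first by rewrite h2 (sP k).2.
  move=> z zq zL; apply: contrapT => /negP zn; apply: none; by exists z.
have finj : injective f.
  move=> k k' e; apply/eqP; apply: contraT => ne.
  have [h1 _ h3] := Hf k; have [h4 _ _] := Hf k'.
  by rewrite (disj k k') // e in h3.
have u : uniq (map f (seq.iota 0 (size L).+1)) by rewrite map_inj_uniq ?iota_uniq.
have sub : {subset map f (seq.iota 0 (size L).+1) <= L}.
  by move=> z /mapP[k _ ->]; have [] := Hf k.
by have := uniq_leq_size u sub; rewrite size_map size_iota ltnn.
Qed.

(** * The ladders and their layered drawings *)

Section UnitInterval.
Variable R : realType.
Implicit Types (s t x y : R) (a b : nat).

Lemma nat_add_unit a b t : 0 <= t <= 1 -> a%:R = b%:R + t ->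
  a = b /\ t = 0 \/ a = b.+1 /\ t = 1.
Proof.
move=> t01 e.
have ba : (b <= a)%N by rewrite -(ler_nat R); lra.
have ab : (a <= b.+1)%N by rewrite -(ler_nat R) -natr1; lra.
have [eab|nab] := eqVneq a b; [left|right]; split=> //.
- by move: e; rewrite eab; lra.
- lia.
- have eab : a = b.+1 by lia.
  by move: e; rewrite eab -natr1; lra.
Qed.

Lemma nat_add_unit_inj a b s t : 0 < s < 1 -> 0 < t < 1 ->
  a%:R + s = b%:R + t -> a = b /\ s = t.
Proof.
move=> hs ht e; have eab : a = b.
  apply/eqP; rewrite eqn_leq -[(a <= b)%N]ltnS -[(b <= a)%N]ltnS -!(ltr_nat R) -!natr1.
  by apply/andP; split; lra.
by split=> //; move: e; rewrite eab; lra.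
Qed.

Lemma convex_comb_lt t x x' y y' : 0 < t < 1 -> x < x' -> y <= y' ->
  (1 - t) * x + t * y <> (1 - t) * x' + t * y'.
Proof.
by move=> /andP[t0 t1] xx yy; apply/eqP; rewrite lt_eqF // ltr_leD // ?ltr_pM2l ?ler_pM2l ?subr_gt0.
Qed.

Lemma convex_comb_inj t x y y' : 0 < t ->
  (1 - t) * x + t * y = (1 - t) * x + t * y' -> y = y'.
Proof. by move=> t0 /addrI /mulfI; apply; rewrite gt_eqF. Qed.

End UnitInterval.

(** * Straight-line drawings with vertices on integer levels *)

Section LayeredDrawing.
Variables (R : realType) (H : sgraph) (X : H -> R) (lev : H -> nat).
Hypothesis X_inj : forall u v, X u = X v -> lev u = lev v -> u = v.
Hypothesis edge_lev : forall u v : H, edge u v -> lev v = (lev u).+1 \/ lev u = (lev v).+1.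
Hypothesis noncrossing : forall u v u' v' : H, edge u v -> edge u' v' ->
  lev v = (lev u).+1 -> lev v' = (lev u').+1 -> lev u = lev u' ->
  X u < X u' -> X v <= X v'.

Let pos (v : H) : 'rV[R]_2 := \row_(j < 2) if j == 0 then X v else (lev v)%:R.

Let posx v : px (pos v) = X v. Proof. by rewrite /px mxE. Qed.
Let posy v : py (pos v) = (lev v)%:R. Proof. by rewrite /py mxE. Qed.

Let posI : injective pos.
Proof.
move=> u v e; apply: X_inj; first by rewrite -!posx e.
by apply/eqP; rewrite -(@eqr_nat R) -!posy e.
Qed.

Let upP u v z : lev v = (lev u).+1 -> segment (pos u) (pos v) z ->
  exists2 t : R, 0 <= t <= 1 &
    px z = (1 - t) * X u + t * X v /\ py z = (lev u)%:R + t.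
Proof.
move=> l /segmentE[t t01 [ex ey]]; exists t => //; split; first by rewrite ex !posx.
by rewrite ey !posy l -natr1; ring.
Qed.

Let up_vertex u v w : lev v = (lev u).+1 -> segment (pos u) (pos v) (pos w) ->
  w = u \/ w = v.
Proof.
move=> l /(upP l)[t t01]; rewrite posx posy => -[ex ey].
have [[lw t0]|[lw t1]] := nat_add_unit t01 ey; [left|right]; apply: X_inj.
- by rewrite ex t0; ring.
- exact: lw.
- by rewrite ex t1; ring.
- by rewrite lw l.
Qed.

(** Strictly inside a strip the height fixes the parameter; strict order of the lower ends and weak
    order of the upper ones then keep two edges apart. *)
Let up_meet u v u' v' z : edge u v -> edge u' v' ->
  lev v = (lev u).+1 -> lev v' = (lev u').+1 ->
  segment (pos u) (pos v) z -> segment (pos u') (pos v') z ->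
  z <> pos u -> z <> pos v -> z <> pos u' -> z <> pos v' -> u = u' /\ v = v'.
Proof.
move=> e e' l l' /(upP l)[t t01 [ex ey]] /(upP l')[t' t01' [ex' ey']] n1 n2 n3 n4.
have strict a b (s : R) : lev b = (lev a).+1 -> 0 <= s <= 1 ->
    px z = (1 - s) * X a + s * X b -> py z = (lev a)%:R + s ->
    z <> pos a -> z <> pos b -> 0 < s < 1.
  move=> lab /andP[s0 s1] fx fy na nb; rewrite !lt_neqAle s0 s1 !andbT.
  apply/andP; split; apply/eqP => es.
    by apply: na; apply: point_eq; rewrite ?posx ?posy ?fx ?fy -es; ring.
  by apply: nb; apply: point_eq; rewrite ?posx ?posy ?fx ?fy es ?lab -?natr1; ring.
have ht := strict _ _ _ l t01 ex ey n1 n2.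
have ht' := strict _ _ _ l' t01' ex' ey' n3 n4.
rewrite ey in ey'; have [ll tt] := nat_add_unit_inj ht ht' ey'.
subst t'; rewrite ex in ex'; have xu : X u = X u'.
  have [h|h|//] := ltgtP (X u) (X u').
    by case: (convex_comb_lt ht h (noncrossing e e' l l' ll h)).
  by case: (convex_comb_lt ht h (noncrossing e' e l' l (esym ll) h)).
have xv : X v = X v'.
  by move: ex'; rewrite xu; apply: convex_comb_inj; case/andP: ht.
by split; apply: X_inj => //; rewrite l l' ll.
Qed.

Let arc_up u v : edge u v -> exists a b, [/\ edge a b, lev b = (lev a).+1,
  segment (pos u) (pos v) = segment (pos a) (pos b) & a = u /\ b = v \/ a = v /\ b = u].
Proof.
move=> e; case: (edge_lev e) => l; first by exists u, v; split=> //; left.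
by exists v, u; split=> //; [rewrite edge_sym|rewrite segmentC|right].
Qed.

Lemma layered_planar : planar R H.
Proof.
exists pos, (fun u v => segment (pos u) (pos v)); split.
- exact: posI.
- by move=> u v _; rewrite segmentC.
- move=> u v e; exists [:: pos u; pos v]; split=> //.
    split.
      rewrite /= andbT inE; apply/eqP => /posI e'.
      by rewrite e' edge_irrefl in e.
    by move=> [|i] [|[|j]].
  apply/seteqP; split=> [z hz|z [[|i] //= _]]; first by exists 0%N.
- move=> u v u' v' e e' ns; apply/seteqP; split=> // z [[/= h1 h2] [/= h3 h4]].
  have [a [b [eab lab eqs ab]]] := arc_up e.
  have [a' [b' [eab' lab' eqs' ab']]] := arc_up e'.
  rewrite eqs in h1; rewrite eqs' in h3.
  have [||||ea eb] := up_meet eab eab' lab lab' h1 h3.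
  + by move=> ez; apply: h2; case: ab => -[<- <-]; [left|right].
  + by move=> ez; apply: h2; case: ab => -[<- <-]; [right|left].
  + by move=> ez; apply: h4; case: ab' => -[<- <-]; [left|right].
  + by move=> ez; apply: h4; case: ab' => -[<- <-]; [right|left].
  exfalso; move/negP: ns; apply; rewrite /same_edge.
  by subst a' b'; case: ab => -[<- <-]; case: ab' => -[<- <-]; rewrite !eqxx ?orbT.
- move=> u v w e; have [a [b [eab lab -> ab]]] := arc_up e.
  move=> /(up_vertex lab); case: ab => -[-> ->] //; tauto.
Qed.

End LayeredDrawing.

(* a s_i, s_i r_i, r_i b, s_i s_{i+1}, r_i r_{i+1} and the i-th diagonal *)
Inductive edge_kind := AS | SR | RB | SS | RR | DD.

(** * The thickened ladders and the order of their strands *)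

Section Ladder.
Variable A : nat -> bool.
Local Open Scope nat_scope.

(** All levels are even, so the ends of a strand are at least two levels apart and each parallel
    copy has an inner vertex. *)
Definition s_at i := (4 * i, if odd i then 6 else 8).
Definition r_at i := (4 * i, if odd i then 2 else 4).

(* (column, lower end, upper end), ends being given as (abscissa, level).  The
   k-th parallel copy of an edge rises from its lower end to its upper end through
   points of abscissa column + k/(k+1), one on each level strictly in between.
   The levels alternate so that every edge of the ladder can be drawn monotonely,
   and the columns between 4i and 4i+4 are ordered so that no two edges cross. *)
Definition strand (e : edge_kind) (i : nat) : nat * (nat * nat) * (nat * nat) :=
  match e with
  | AS => (4 * i, s_at i, (0, 10))
  | SR => (4 * i, r_at i, s_at i)
  | RB => (4 * i, (0, 0), r_at i)
  | SS => if odd i then (4 * i + 1, s_at i, s_at i.+1) else (4 * i + 3, s_at i.+1, s_at i)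
  | RR => if odd i then (4 * i + 3, r_at i, r_at i.+1) else (4 * i + 1, r_at i.+1, r_at i)
  | DD => if A i then (4 * i + 2, r_at i.+1, s_at i) else (4 * i + 2, r_at i, s_at i.+1)
  end.

Definition column e i := (strand e i).1.1.
Definition low_end e i := (strand e i).1.2.
Definition high_end e i := (strand e i).2.

Lemma strand_bounds e i :
  [/\ 4 * i <= column e i < 4 * i + 4,
      (low_end e i).2 = 0 /\ (low_end e i).1 = 0 \/
        (low_end e i).2 <> 0 /\ 4 * i <= (low_end e i).1 <= 4 * i + 4,
      (high_end e i).2 = 10 /\ (high_end e i).1 = 0 \/
        (high_end e i).2 <> 10 /\ 4 * i <= (high_end e i).1 <= 4 * i + 4 &
      (low_end e i).2.+1 < (high_end e i).2 <= 10].
Proof.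
rewrite /column /low_end /high_end.
by case: e; rewrite /strand /s_at /r_at /=; case: (odd i) => //=;
  try case: (A i); rewrite /=; split; lia.
Qed.

(** The left-right order at the bottom and top of a strip crossed by both strands. Inner points lie
    less than one to the right of their column, hence the strict inequality when such a point
    precedes an end. *)
Lemma strand_order e i e' i' t : column e i < column e' i' ->
  (low_end e i).2 <= t < (high_end e i).2 -> (low_end e' i').2 <= t < (high_end e' i').2 ->
  [/\ (low_end e i).2 = t -> (low_end e' i').2 = t -> (low_end e i).1 <= (low_end e' i').1,
      (low_end e i).2 = t -> (low_end e' i').2 <> t -> (low_end e i).1 <= column e' i' &
      (low_end e i).2 <> t -> (low_end e' i').2 = t -> column e i < (low_end e' i').1] /\
  [/\ (high_end e i).2 = t.+1 -> (high_end e' i').2 = t.+1 -> (high_end e i).1 <= (high_end e' i').1,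
      (high_end e i).2 = t.+1 -> (high_end e' i').2 <> t.+1 -> (high_end e i).1 <= column e' i' &
      (high_end e i).2 <> t.+1 -> (high_end e' i').2 = t.+1 -> column e i < (high_end e' i').1].
Proof.
have [c1 b1 t1 l1] := strand_bounds e i; have [c2 b2 t2 l2] := strand_bounds e' i'.
move=> cc h1 h2; have [ii|ii|ii] := ltngtP i i'.
(* Different cells are separated by the bounds; within one cell all kinds and parities are
   checked. *)
- split; split=> e1 e2; clear cc.
  all: try by (clear -h1 b1 b2 e1 e2 ii c1 c2; lia).
  all: try by (clear -h1 l1 t1 t2 e1 e2 ii c1 c2; lia).
- by exfalso; clear -c1 c2 cc ii; lia.
- subst i'; move: cc h1 h2 {c1 b1 t1 l1 c2 b2 t2 l2}; rewrite /column /low_end /high_end.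
  case: e; case: e'; rewrite /strand /s_at /r_at /=; case: (odd i); rewrite /=;
    try (case: (A i); rewrite /=); move=> h1 h2 h3;
    try (by exfalso; clear -h1; lia); try (by exfalso; clear -h2 h3; lia);
    clear h1; split; split=> // e1 e2; try (by exfalso; clear -h2 h3 e1 e2; lia);
    clear; lia.
Qed.

(** [AS], [SR] and [RB] share a column but lie one above the other; each other column of a cell
    carries a single kind. *)
Lemma strand_col_inj e i e' i' t : column e i = column e' i' ->
  (low_end e i).2 <= t < (high_end e i).2 -> (low_end e' i').2 <= t < (high_end e' i').2 ->
  strand e i = strand e' i'.
Proof.
have [c1 _ _ _] := strand_bounds e i; have [c2 _ _ _] := strand_bounds e' i'.
move=> cc; have ii : i = i' by lia.
subst i'; move: cc {c1 c2}; rewrite /column /low_end /high_end.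
by case: e; case: e'; rewrite /strand /s_at /r_at /=; case: (odd i); rewrite /=;
  try (case: (A i); rewrite /=); move=> *; (reflexivity || (exfalso; lia)).
Qed.


(** The last coordinate is 0 at the ends, which all copies share, and [k.+1] inside the [k]-th
    copy. *)
Definition node e i k t : nat * nat * nat :=
  if t == (low_end e i).2 then (low_end e i, 0)
  else if t == (high_end e i).2 then (high_end e i, 0) else (column e i, t, k.+1).

Definition up (u v : nat * nat * nat) : Prop := exists e i k t,
  [/\ (low_end e i).2 <= t < (high_end e i).2, u = node e i k t & v = node e i k t.+1].

Lemma node_level e i k t : (low_end e i).2 <= t <= (high_end e i).2 -> (node e i k t).1.2 = t.
Proof.
by move=> h; rewrite /node; case: eqP => [->|_] //; case: eqP => [->|_].
Qed.

Definition ladder_edge (u v : nat * nat * nat) : bool := `[< up u v \/ up v u >].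

Lemma up_level u v : up u v -> v.1.2 = u.1.2.+1.
Proof.
move=> [e [i [k [t [/andP[h1 h2] -> ->]]]]].
by rewrite !node_level ?h1 ?h2 ?(ltnW h2) ?(leqW h1).
Qed.

Lemma ladder_sym : symmetric ladder_edge.
Proof. by move=> u v; apply: asbool_equiv_eq; split; case; [right|left|right|left]. Qed.

Lemma ladder_irrefl : irreflexive ladder_edge.
Proof. by move=> u; apply/asboolP => -[] /up_level; lia. Qed.

(** All triples are vertices whatever [A], those off the strands being isolated; so embeddings of
    different ladders have a common domain. *)
Definition ladder := SGraph ladder_sym ladder_irrefl.

(** [left] is an integer test for the order of abscissas: only inner vertices add a fraction below 1
    to their column. *)
Lemma node_order e i e' i' k k' t : column e i < column e' i' ->
  (low_end e i).2 <= t < (high_end e i).2 -> (low_end e' i').2 <= t < (high_end e' i').2 ->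
  let left (u v : nat * nat * nat) := u.1.1 + (0 < u.2) <= v.1.1 in
  left (node e i k t) (node e' i' k' t) /\
  left (node e i k t.+1) (node e' i' k' t.+1).
Proof.
move=> cc h1 h2 left; have [[o1 o2 o3] [o4 o5 o6]] := strand_order cc h1 h2.
have nt d j : (low_end d j).2 <= t < (high_end d j).2 -> (t == (high_end d j).2) = false /\
    (t.+1 == (low_end d j).2) = false by move=> h; split; lia.
rewrite /left /node !(nt _ _ h1).1 !(nt _ _ h1).2 !(nt _ _ h2).1 !(nt _ _ h2).2.
split.
  case: (eqVneq t (low_end e i).2) => [e1|/eqP/nesym e1]; case: (eqVneq t (low_end e' i').2) => [e2|/eqP/nesym e2] /=;
  rewrite ?addn0 ?addn1 //; [exact: o1|exact: o2|exact: o3].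
case: (eqVneq t.+1 (high_end e i).2) => [e1|/eqP/nesym e1]; case: (eqVneq t.+1 (high_end e' i').2) => [e2|/eqP/nesym e2] /=;
rewrite ?addn0 ?addn1 //; [exact: o4|exact: o5|exact: o6].
Qed.

End Ladder.

(** * Plane drawings of the ladders *)

Section LadderDrawing.
Variables (R : realType) (A : nat -> bool).

Let X (v : ladder A) : R := v.1.1%:R + v.2%:R / v.2.+1%:R.

Let frac_lt1 k : 0 <= (k%:R / k.+1%:R : R) < 1.
Proof. by rewrite divr_ge0 //= ltr_pdivrMr // mul1r ltr_nat. Qed.

Let frac_lt k k' : ((k%:R / k.+1%:R : R) < k'%:R / k'.+1%:R) = (k < k')%N.
Proof.
rewrite ltr_pdivrMr // mulrAC ltr_pdivlMr // -!natrM ltr_nat; lia.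
Qed.

Let X_left u v : (u.1.1 + (0 < u.2) <= v.1.1)%N -> X u <= X v.
Proof.
rewrite /X => h; have /andP[f0 f1] := frac_lt1 u.2; have /andP[g0 g1] := frac_lt1 v.2.
move: h; rewrite -(ler_nat R) natrD; case: (posnP u.2) => [->|_]; last first.
  rewrite /=; move: (_ / _) (_ / _) f1 g0 => a b; lra.
rewrite /= mul0r; move: (_ / _) g0 => a; lra.
Qed.

Let X_inj u v : X u = X v -> u.1.2 = v.1.2 -> u = v.
Proof.
move: u v => [[m t] k] [[m' t'] k']; rewrite /X /= => e ->.
have /andP[f0 f1] := frac_lt1 k; have /andP[g0 g1] := frac_lt1 k'.
have mm : m = m'.
  apply/eqP; rewrite eqn_leq -[(m <= m')%N]ltnS -[(m' <= m)%N]ltnS -!(ltr_nat R) -!natr1.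
  by move: (_ / _) (_ / _) f0 f1 g0 g1 e => a b *; apply/andP; split; lra.
congr (_, _, _) => //; move: e; rewrite mm => /addrI e.
by have := frac_lt k k'; have := frac_lt k' k; rewrite e ltxx; lia.
Qed.

Lemma ladder_planar : planar R (ladder A).
Proof.
apply: (@layered_planar R (ladder A) X (fun v => v.1.2)).
- exact: X_inj.
- by move=> u v /asboolP[] /up_level; [left|right].
move=> u v u' v' /asboolP uv /asboolP uv' l l' ll.
have {l}{}uv : up A u v by case: uv => // /up_level; rewrite l; move: (u.1.2) => n; lia.
have {l'}{}uv' : up A u' v' by case: uv' => // /up_level; rewrite l'; move: (u'.1.2) => n; lia.
move: uv uv' => [e [i [k [t [h eu ev]]]]] [e' [i' [k' [t' [h' eu' ev']]]]].
have tt : t' = t.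
  by move: ll; rewrite eu eu' !node_level; lia.
subst t'; have [cc|cc|cc] := ltngtP (column A e i) (column A e' i').
- by move=> _; rewrite ev ev'; apply: X_left; case: (node_order k k' cc h h').
- rewrite ltNge => /negP[]; rewrite eu eu'; apply: X_left.
  by case: (node_order k' k cc h' h).
(* Equal columns in a common strip give the same strand, whose copies are ordered by their
   numbers. *)
have es := strand_col_inj cc h h'.
have en m s : node A e' i' m s = node A e i m s by rewrite /node /low_end /high_end /column es.
have mono m n s : (m <= n)%N -> X (node A e i m s) <= X (node A e i n s).
  move=> mn; rewrite /X /node; case: ifP => // _; case: ifP => // _ /=.
  by rewrite lerD2l leNgt frac_lt -leqNgt.
rewrite eu eu' ev ev' !en; case: (leqP k k') => kk; first by move=> _; apply: mono.
by rewrite ltNge => /negP[]; apply/mono/ltnW.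
Qed.

Lemma ladder_countable : countable_graph (ladder A).
Proof. exact: countableP. Qed.

End LadderDrawing.

(** * Ladders in a planar graph *)

Local Open Scope nat_scope.

Lemma path_map_iota (T : Type) (r : rel T) (f : nat -> T) a n :
  (forall t, a <= t < a + n -> r (f t) (f t.+1)) ->
  path r (f a) [seq f t | t <- iota a.+1 n] /\
  last (f a) [seq f t | t <- iota a.+1 n] = f (a + n).
Proof.
elim: n a => [|n IH] a H /=; first by rewrite addn0.
have [|h1 h2] := IH a.+1; first by move=> t ht; apply: H; lia.
by rewrite h1 h2 H ?addSnnS //; lia.
Qed.

(** The parallel copies serve as strands: their inner vertices are told apart by the copy number. *)
Lemma linked_strand (A : nat -> bool) (U : sgraph) (emb : ladder A -> U)
    (ipath : ladder A -> ladder A -> seq U) e i :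
  graph_embedding emb ipath ->
  linked (emb (low_end A e i, 0)) (emb (high_end A e i, 0)).
Proof.
move=> embP; have [_ _ _ /andP[bt _]] := strand_bounds A e i.
set b := (low_end A e i).2 in bt *; set n := (high_end A e i).2 - b.
have nb k : node A e i k b = (low_end A e i, 0) by rewrite /node /b eqxx.
have nt k : node A e i k (high_end A e i).2 = (high_end A e i, 0).
  by rewrite /node eqxx ifF // gtn_eqF // ltnW.
have mid k t : b < t < (high_end A e i).2 -> node A e i k t = (column A e i, t, k.+1).
  by move=> h; rewrite /node !ifF //; apply/eqP; rewrite -/b; lia.
pose s k : seq (ladder A) := [seq node A e i k t | t <- iota b.+1 n].
have inter k t : b <= t <= (high_end A e i).2 -> node A e i k t \in
    [:: (low_end A e i, 0); (high_end A e i, 0)] \/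
    (node A e i k t).2 = k.+1 /\ (node A e i k t \notin
    [:: (low_end A e i, 0); (high_end A e i, 0)]).
  move=> h; case: (eqVneq t b) => [->|tb]; first by rewrite nb inE eqxx; left.
  case: (eqVneq t (high_end A e i).2) => [->|tt]; first by rewrite nt !inE eqxx orbT; left.
  right; rewrite mid; last by lia.
  by split=> //; rewrite !inE !xpair_eqE /= !andbF.
apply: (linked_of_strands (s := s) embP).
  move=> k; rewrite -(nb k) -(nt k).
  have [|h1 h2] := @path_map_iota _ (fun u v : ladder A => edge u v &&
    ~~ ((u \in [:: node A e i k b; node A e i k (high_end A e i).2]) &&
        (v \in [:: node A e i k b; node A e i k (high_end A e i).2]))) (node A e i k) b n.
    move=> t ht; have ht' : b <= t < (high_end A e i).2 by lia.
    apply/andP; split; first by apply/asboolP; left; exists e, i, k, t.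
    (* One end of the edge is inner: the upper one at the lowest level, the lower one otherwise. *)
    rewrite (nb k) (nt k); case: (eqVneq t b) => [tb|tb].
      rewrite andbC [X in X && _](_ : _ = false) // mid; last by lia.
      by rewrite !inE !xpair_eqE /= !andbF.
    rewrite [X in X && _](_ : _ = false) // mid; last by lia.
    by rewrite !inE !xpair_eqE /= !andbF.
  by split=> //; rewrite /s h2; congr node; lia.
have spos k z : z \in (low_end A e i, 0) :: s k ->
    z \in [:: (low_end A e i, 0); (high_end A e i, 0)] \/ z.2 = k.+1 /\ (z \notin
    [:: (low_end A e i, 0); (high_end A e i, 0)]).
  rewrite inE => /predU1P[->|/mapP[t]]; first by left; rewrite inE eqxx.
  by rewrite mem_iota => ht ->; apply: inter; lia.
move=> k k' z kk' /spos[//|[z1 _]] /spos[//|[z2 _]].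
by move: kk'; rewrite -eqSS -z1 -z2 eqxx.
Qed.

(** * [K_{3,3}] obstructions in consecutive rungs *)

Section Cell.
Variables (R : realType) (U : sgraph).
Hypothesis plU : planar R U.
Implicit Types a b v w s r : U.

(** Two apexes and four consecutive rungs, without diagonals: two known rungs, the rung [s r] to be
    determined, and [s2 r2] for a detour beyond it. *)
Definition cell a b v0 w0 v w s r s2 r2 : Prop :=
  uniq [:: a; b; v0; w0; v; w; s; r; s2; r2] /\
  [/\ [/\ linked a v0, linked a v, linked a s & linked a s2],
      [/\ linked b w0, linked b w, linked b r & linked b r2],
      [/\ linked v0 w0, linked v w, linked s r & linked s2 r2],
      [/\ linked v0 v, linked v s & linked s s2] &
      [/\ linked w0 w, linked w r & linked r r2]].

Ltac split_andb := repeat match goal with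
  | H : is_true (andb _ _) |- _ =>
      let H1 := fresh in let H2 := fresh in case/andP: H => H1 H2
  end.

Ltac neq_list := rewrite /= ?inE ?negb_or; split_andb;
  repeat (apply/andP; split); try done; try by rewrite eq_sym.

Ltac linked_list := repeat split; try assumption; apply: linked_sym; assumption.

Lemma cell_sym a b v0 w0 v w s r s2 r2 : cell a b v0 w0 v w s r s2 r2 ->
  cell b a w0 v0 w v r s r2 s2.
Proof.
move=> [un [[l1 l2 l3 l4] [l5 l6 l7 l8] [l9 l10 l11 l12] [l13 l14 l15] [l16 l17 l18]]].
split; last by linked_list.
by move: un; rewrite /= !inE !negb_or => un; neq_list.
Qed.

(** Sides [s], [s'], [v0] and [a], [v], [b]; the vertex [b] is reached through [r], [r'], [w0]. *)
Lemma cell_disjoint a b v0 w0 v w s r s2 r2 s' r' s2' r2' :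
  cell a b v0 w0 v w s r s2 r2 -> cell a b v0 w0 v w s' r' s2' r2' ->
  s != s' -> s != r' -> r != s' -> r != r' -> False.
Proof.
move=> [un [[l1 l2 l3 l4] [l5 l6 l7 l8] [l9 l10 l11 l12] [l13 l14 l15] [l16 l17 l18]]].
move=> [un' [[m1 m2 m3 m4] [m5 m6 m7 m8] [m9 m10 m11 m12] [m13 m14 m15] [m16 m17 m18]]].
move=> n1 n2 n3 n4.
apply: (@K33_linked U R [:: a; b; v0; w0; v; s; r; s'; r'] a [:: 5; 7; 2] [:: 0; 4; 1]
  [:: [:: [:: 0]; [:: 4]; [:: 6; 1]]; [:: [:: 0]; [:: 4]; [:: 8; 1]];
      [:: [:: 0]; [:: 4]; [:: 3; 1]]]
  [:: (5, 0); (5, 4); (5, 6); (1, 6); (7, 0); (7, 4); (7, 8); (1, 8); (2, 0); (2, 4);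
      (2, 3); (1, 3)] plU) => //; last by linked_list.
by move: un un'; rewrite /= !inE !negb_or => un un'; neq_list.
Qed.

(** Sides [r], [r'], [w0] and [s], [w], [b]; [w0] reaches [s] through [v0], [v]. *)
Lemma cell_same_left a b v0 w0 v w s r s2 r2 r' s2' r2' :
  cell a b v0 w0 v w s r s2 r2 -> cell a b v0 w0 v w s r' s2' r2' -> r = r'.
Proof.
move=> [un [[l1 l2 l3 l4] [l5 l6 l7 l8] [l9 l10 l11 l12] [l13 l14 l15] [l16 l17 l18]]].
move=> [un' [[m1 m2 m3 m4] [m5 m6 m7 m8] [m9 m10 m11 m12] [m13 m14 m15] [m16 m17 m18]]].
apply/eqP; apply: contraT => n1; exfalso.
apply: (@K33_linked U R [:: b; v0; w0; v; w; s; r; r'] a [:: 6; 7; 2] [:: 5; 4; 0]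
  [:: [:: [:: 5]; [:: 4]; [:: 0]]; [:: [:: 5]; [:: 4]; [:: 0]];
      [:: [:: 1; 3; 5]; [:: 4]; [:: 0]]]
  [:: (6, 5); (6, 4); (6, 0); (7, 5); (7, 4); (7, 0); (2, 1); (1, 3); (3, 5); (2, 4);
      (2, 0)] plU) => //; last by linked_list.
by move: un un'; rewrite /= !inE !negb_or => un un'; neq_list.
Qed.

(** Sides [a], [s], [w] and [r], [b], [v]; [a] reaches [b] through [v0], [w0], and [s] reaches it
    through [s2], [r2]. *)
Lemma cell_no_chord a b v0 w0 v w s r s2 r2 :
  cell a b v0 w0 v w s r s2 r2 -> linked a r -> False.
Proof.
move=> [un [[l1 l2 l3 l4] [l5 l6 l7 l8] [l9 l10 l11 l12] [l13 l14 l15] [l16 l17 l18]]] lar.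
apply: (@K33_linked U R [:: a; b; v0; w0; v; w; s; r; s2; r2] a [:: 0; 6; 5] [:: 7; 1; 4]
  [:: [:: [:: 7]; [:: 2; 3; 1]; [:: 4]]; [:: [:: 7]; [:: 8; 9; 1]; [:: 4]];
      [:: [:: 7]; [:: 1]; [:: 4]]]
  [:: (0, 7); (0, 2); (2, 3); (3, 1); (0, 4); (6, 7); (6, 8); (8, 9); (9, 1); (6, 4);
      (5, 7); (5, 1); (5, 4)] plU) => //; last by linked_list.
Qed.

(** If only one pair agrees, [cell_same_left] applies, up to symmetry; a crosswise coincidence
    yields a chord from an apex; otherwise the rungs are disjoint. *)
Lemma cell_determined a b v0 w0 v w s r s2 r2 s' r' s2' r2' :
  cell a b v0 w0 v w s r s2 r2 -> cell a b v0 w0 v w s' r' s2' r2' ->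
  s = s' /\ r = r'.
Proof.
move=> c c'; have [_ [[_ _ las' _] [_ _ lbr' _] _ _ _]] := c'.
have [ss|ns] := eqVneq s s'; first by subst s'; split=> //; exact: cell_same_left c c'.
have [rr|nr] := eqVneq r r'.
  by subst r'; split=> //; exact: cell_same_left (cell_sym c) (cell_sym c').
exfalso; have [rs|nrs] := eqVneq r s'.
  by subst s'; exact: cell_no_chord c las'.
have [sr|nsr] := eqVneq s r'.
  by subst r'; exact: cell_no_chord (cell_sym c) lbr'.
exact: cell_disjoint c c' ns nsr nrs nr.
Qed.

(** Sides [s], [s1], [b] and [r], [r1], [a]; [b] reaches [a] through [r2], [s2]. *)
Lemma no_crossing_diagonals a b s r s1 r1 s2 r2 :
  uniq [:: a; b; s; r; s1; r1; s2; r2] ->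
  [/\ linked a s, linked a s1, linked a s2 & linked s2 r2] ->
  [/\ linked b r, linked b r1 & linked b r2] ->
  [/\ linked s r, linked s1 r1, linked s r1 & linked s1 r] -> False.
Proof.
move=> un [l1 l2 l3 l4] [l5 l6 l7] [l8 l9 l10 l11].
apply: (@K33_linked U R [:: a; b; s; r; s1; r1; s2; r2] a [:: 2; 4; 1] [:: 3; 5; 0]
  [:: [:: [:: 3]; [:: 5]; [:: 0]]; [:: [:: 3]; [:: 5]; [:: 0]];
      [:: [:: 3]; [:: 5]; [:: 7; 6; 0]]]
  [:: (2, 3); (2, 5); (2, 0); (4, 3); (4, 5); (4, 0); (1, 3); (1, 5); (1, 7); (7, 6);
      (6, 0)] plU) => //; last by linked_list.
Qed.

End Cell.

(** * Linkages in an embedded ladder *)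

Section EmbeddedLadder.
Variables (R : realType) (U : sgraph) (A : nat -> bool).
Variables (emb : nat * nat * nat -> U) (ipath : ladder A -> ladder A -> seq U).
Hypothesis embP : @graph_embedding (ladder A) U emb ipath.

Definition apex_a : nat * nat * nat := (0, 10, 0).
Definition apex_b : nat * nat * nat := (0, 0, 0).
Definition s_node i : nat * nat * nat := (s_at i, 0).
Definition r_node i : nat * nat * nat := (r_at i, 0).

Let strand_link e i : linked (emb (low_end A e i, 0)) (emb (high_end A e i, 0)).
Proof. exact: (linked_strand e i embP). Qed.

Lemma linked_as i : linked (emb apex_a) (emb (s_node i)).
Proof. exact: linked_sym (strand_link AS i). Qed.

Lemma linked_br i : linked (emb apex_b) (emb (r_node i)).
Proof. exact: strand_link RB i. Qed.

Lemma linked_sr i : linked (emb (s_node i)) (emb (r_node i)).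
Proof. exact: linked_sym (strand_link SR i). Qed.

Lemma linked_ss i : linked (emb (s_node i)) (emb (s_node i.+1)).
Proof.
have := strand_link SS i; rewrite /low_end /high_end /=.
by case: (odd i) => //; apply: linked_sym.
Qed.

Lemma linked_rr i : linked (emb (r_node i)) (emb (r_node i.+1)).
Proof.
have := strand_link RR i; rewrite /low_end /high_end /=.
by case: (odd i) => //; apply: linked_sym.
Qed.

Lemma linked_diag i : if A i then linked (emb (s_node i)) (emb (r_node i.+1))
  else linked (emb (s_node i.+1)) (emb (r_node i)).
Proof.
have := strand_link DD i; rewrite /low_end /high_end /=.
by case: (A i); apply: linked_sym.
Qed.

Lemma ladder_cell i : cell (emb apex_a) (emb apex_b) (emb (s_node i)) (emb (r_node i))
  (emb (s_node i.+1)) (emb (r_node i.+1)) (emb (s_node i.+2)) (emb (r_node i.+2))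
  (emb (s_node i.+3)) (emb (r_node i.+3)).
Proof.
split; last by split; split; first [exact: linked_as | exact: linked_br | exact: linked_sr
  | exact: linked_ss | exact: linked_rr].
have inj : injective emb := iota_inj embP.
rewrite -[X in uniq X]/(map emb [:: apex_a; apex_b; s_node i; r_node i; s_node i.+1;
  r_node i.+1; s_node i.+2; r_node i.+2; s_node i.+3; r_node i.+3]).
rewrite map_inj_uniq // /apex_a /apex_b /s_node /r_node /s_at /r_at /=.
by case: (odd i); rewrite /= !inE !xpair_eqE /=; lia.
Qed.

End EmbeddedLadder.

Lemma agree_everywhere (R : realType) (U : sgraph) (A B : nat -> bool)
    (f g : nat * nat * nat -> U) fpath gpath :
  planar R U -> @graph_embedding (ladder A) U f fpath ->
  @graph_embedding (ladder B) U g gpath ->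
  f apex_a = g apex_a -> f apex_b = g apex_b ->
  f (s_node 0) = g (s_node 0) -> f (r_node 0) = g (r_node 0) ->
  f (s_node 1) = g (s_node 1) -> f (r_node 1) = g (r_node 1) ->
  forall i, f (s_node i) = g (s_node i) /\ f (r_node i) = g (r_node i).
Proof.
move=> plU fP gP ea eb es0 er0 es1 er1.
(* Two consecutive rungs are carried through the induction, as [cell_determined] starts from two. *)
suff H i : [/\ f (s_node i) = g (s_node i), f (r_node i) = g (r_node i),
    f (s_node i.+1) = g (s_node i.+1) & f (r_node i.+1) = g (r_node i.+1)].
  by move=> i; case: (H i).
elim: i => [//|i [e1 e2 e3 e4]].
have cf := ladder_cell fP i; have cg := ladder_cell gP i.
rewrite -ea -eb -e1 -e2 -e3 -e4 in cg.
by have [-> ->] := cell_determined plU cf cg.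
Qed.

Lemma conflicting_diagonals (R : realType) (U : sgraph) (A B : nat -> bool)
    (f g : nat * nat * nat -> U) fpath gpath n :
  planar R U -> @graph_embedding (ladder A) U f fpath ->
  @graph_embedding (ladder B) U g gpath ->
  (forall i, f (s_node i) = g (s_node i) /\ f (r_node i) = g (r_node i)) ->
  A n -> ~~ B n -> False.
Proof.
move=> plU fP gP fg An Bn.
have dA := linked_diag fP n; rewrite An in dA.
have := linked_diag gP n.
rewrite (negPf Bn) -(fg n).2 -(fg n.+1).1 => dB.
have [un _] := ladder_cell fP n.
apply: (no_crossing_diagonals plU (a := f apex_a) (b := f apex_b) (s := f (s_node n))
  (r := f (r_node n)) (s1 := f (s_node n.+1)) (r1 := f (r_node n.+1))
  (s2 := f (s_node n.+2)) (r2 := f (r_node n.+2))).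
- apply: subseq_uniq un; by rewrite /= !eqxx.
- by split; [exact: (linked_as fP)..|exact: (linked_sr fP)].
- by split; exact: (linked_br fP).
- by split=> //; exact: (linked_sr fP).
Qed.

(** Cantor's diagonal argument: [D] contains its own code, so some predicate with the same value of
    [F] omits that code. *)
Lemma no_injection_powerset (T : countType) (F : (nat -> bool) -> T) :
  exists A B n, [/\ F A = F B, A n & ~~ B n].
Proof.
pose D n := `[< exists2 A : nat -> bool, pickle (F A) = n & ~~ A n >].
have [[A FA AF]|nD] := pselect (exists2 A : nat -> bool,
    pickle (F A) = pickle (F D) & ~~ A (pickle (F D))).
  exists D, A, (pickle (F D)); split=> //; last by apply/asboolP; exists A.
  exact/esym/(pcan_inj pickleK).
by have h := nD; case: nD; exists D => //; apply/asboolPn.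
Qed.

Theorem theorem1p1 (R : realType) :
  ~ exists U : sgraph,
      [/\ countable_graph U,
          planar R U
        & forall H : sgraph,
            countable_graph H -> planar R H -> topological_minor H U].
Proof.
move=> [U [cU plU univ]].
have /choice[emb embP] : forall A, exists f : nat * nat * nat -> U,
    exists fpath, @graph_embedding (ladder A) U f fpath.
  by move=> A; apply: (univ (ladder A)); [exact: ladder_countable|exact: ladder_planar].
have /countable_injP[code code_inj] := cU.
(* The images of the apexes and of the first two rungs, coded in the countable type [seq nat]. *)
pose F A := map (fun x => code (emb A x)) [:: apex_a; apex_b; s_node 0; r_node 0;
  s_node 1; r_node 1].
have [A [B [n [FAB An Bn]]]] := no_injection_powerset F.
have [fA fP] := embP A; have [gB gP] := embP B.
have ci x y : code x = code y -> x = y by move=> e; apply: code_inj e; rewrite in_setT.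
case: FAB => /ci e1 /ci e2 /ci e3 /ci e4 /ci e5 /ci e6.
exact: (conflicting_diagonals plU fP gP (agree_everywhere plU fP gP e1 e2 e3 e4 e5 e6) An Bn).
Qed.
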